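(* Let $X$ be a continuously graded ordered set. Then there are well-defined functions $\partial^-$ and $\partial^+$ on the positive-dimensional elements of $X$ such that $\partial^- x$ is the last $(|x|-1)$-dimensional element preceding $x$ in the ordering and $\partial^+ x$ is the first $(|x|-1)$-dimensional element following $x$ in the ordering, and these functions make $X$ into a simple globular set. Every simple globular set arises from a continuously graded ordered set in this way.
   Context: A globular set is a set in which: every element $x$ is assigned a nonnegative integer dimension $|x|$; every element $x$ with $|x|>0$ is assigned two $(|x|-1)$-dimensional elements $\partial^- x$ (its source) and $\partial^+ x$ (its target); and if $|x|\geq 2$ then $\partial^-\partial^- x=\partial^-\partial^+ x$ and $\partial^+\partial^- x=\partial^+\partial^+ x$. A simple globular set is a non-empty finite globular set such that the transitive closure of the relation given by $\partial^- x<x$ and $x<\partial^+ x$ (for all $x$ with $|x|>0$) is a (strict) total ordering. A continuously graded ordered set is a non-empty finite totally ordered set, together with a function assigning a nonnegative integer dimension $|x|$ to each element $x$, such that the first and last elements have dimension zero and such that consecutive elements have dimensions differing by exactly $1$. *)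

(* Defs.v *)
From Stdlib Require RelationClasses Relation_Operators.
From mathcomp Require Import all_boot.

Set Implicit Arguments.
Unset Strict Implicit.
Unset Printing Implicit Defensive.

Definition strict_total_order (T : Type) (R : T -> T -> Prop) : Prop :=
  RelationClasses.StrictOrder R /\ forall x y : T, x <> y -> R x y \/ R y x.

(* Functions on the positive-dimensional elements only.  The argument
   [0 < dim x] is a boolean equation, so the value does not depend on which
   proof is supplied. *)
Definition boundary (T : Type) (dim : T -> nat) : Type :=
  forall x : T, 0 < dim x -> T.

(* In the last two fields the hypotheses [0 < dim _] carry no extra content:
   they follow from [1 < dim x] and the first two fields, and only serve to
   make the iterated boundaries well typed. *)
Record globular_set (T : Type) (dim : T -> nat) (src tgt : boundary dim) :
    Prop := GlobularSet {
  dim_src : forall x (hx : 0 < dim x), dim (src x hx) = (dim x).-1;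
  dim_tgt : forall x (hx : 0 < dim x), dim (tgt x hx) = (dim x).-1;
  src_src_tgt : forall x, 1 < dim x ->
    forall (hx : 0 < dim x)
           (hs : 0 < dim (src x hx)) (ht : 0 < dim (tgt x hx)),
    src (src x hx) hs = src (tgt x hx) ht;
  tgt_src_tgt : forall x, 1 < dim x ->
    forall (hx : 0 < dim x)
           (hs : 0 < dim (src x hx)) (ht : 0 < dim (tgt x hx)),
    tgt (src x hx) hs = tgt (tgt x hx) ht
}.

Definition globular_step (T : Type) (dim : T -> nat) (src tgt : boundary dim)
    (x y : T) : Prop :=
  (exists hy : 0 < dim y, x = src y hy) \/
  (exists hx : 0 < dim x, y = tgt x hx).

Record simple_globular_set (T : finType) (dim : T -> nat)
    (src tgt : boundary dim) : Prop := SimpleGlobularSet {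
  simple_globular : globular_set src tgt;
  simple_nonempty : 0 < #|T|;
  simple_order :
    strict_total_order (Relation_Operators.clos_trans T (globular_step src tgt))
}.

Definition is_first (T : finType) (lt : rel T) (x : T) : Prop :=
  forall y : T, y != x -> lt x y.

Definition is_last (T : finType) (lt : rel T) (x : T) : Prop :=
  forall y : T, y != x -> lt y x.

Definition consecutive (T : finType) (lt : rel T) (x y : T) : Prop :=
  lt x y /\ forall z : T, ~ (lt x z /\ lt z y).

Record cont_graded_ordered_set (T : finType) (lt : rel T) (dim : T -> nat) :
    Prop := ContGradedOrderedSet {
  cgos_order : strict_total_order (fun x y : T => lt x y);
  cgos_nonempty : 0 < #|T|;
  cgos_first : forall x : T, is_first lt x -> dim x = 0;
  cgos_last : forall x : T, is_last lt x -> dim x = 0;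
  cgos_step : forall x y : T, consecutive lt x y ->
    dim y = (dim x).+1 \/ dim x = (dim y).+1
}.

Definition last_face_before (T : finType) (lt : rel T) (dim : T -> nat)
    (x y : T) : Prop :=
  [/\ lt y x, dim y = (dim x).-1 &
      forall z : T, lt z x -> dim z = (dim x).-1 -> z != y -> lt z y].

Definition first_face_after (T : finType) (lt : rel T) (dim : T -> nat)
    (x y : T) : Prop :=
  [/\ lt x y, dim y = (dim x).-1 &
      forall z : T, lt x z -> dim z = (dim x).-1 -> z != y -> lt y z].

Definition boundaries_from_order (T : finType) (lt : rel T) (dim : T -> nat)
    (src tgt : boundary dim) : Prop :=
  forall (x : T) (hx : 0 < dim x),
    last_face_before lt dim x (src x hx) /\
    first_face_after lt dim x (tgt x hx).

(* Main.v *)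
Require Import Defs.
From mathcomp Require Import all_boot.
From Stdlib Require Import Relation_Operators Operators_Properties.
From mathcomp Require Import boolp.

Set Implicit Arguments.
Unset Strict Implicit.
Unset Printing Implicit Defensive.

(** In a continuously graded ordered set the dimension cannot skip a value
    ([dim_ivt]).  Hence an element of positive dimension has faces on both
    sides ([last_faceP], and the same for the opposite order), and everything
    strictly between an element x and one of its two faces has dimension at
    least that of x ([last_face_gap]).

    Suppose that x has dimension at least 2, with source s and target t.
    Nothing strictly between s and t has a dimension below that of x, so the
    last element of dimension |x| - 2 before t already precedes s
    ([last_face_src_tgt]); this gives the globular identities.  Consecutive
    elements differ in dimension by 1, so the smaller is the source of the
    larger or the larger is the target of the smaller; since a finite order is
    generated by its consecutive pairs ([lt_clos_consecutive]), it is the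
    transitive closure of the globular steps.

    Conversely, order a simple globular set by that transitive closure.
    Consecutive elements must be related by a single globular step, which gives
    the continuous grading.  That the given source of x is the last possible
    face before x is shown by induction along the order
    ([src_last_face]).  Let p be the predecessor of x.  Either p is the given
    source of x, and there is nothing to prove, or x is the given target of p.
    In the latter case let q be the given source of p, so that the globular
    identity says that x and q have the same given source a.  By induction q is
    the last face before p and a is the last face before q; since x, being
    consecutive to p, is the first face after p, [last_face_src_tgt] shows that
    a is the last face before x.

    Statements about targets are those about sources in the opposite order. *)

(** * Finite strict total orders *)

Definition opposite (T : Type) (lt : rel T) : rel T := fun x y => lt y x.

Section FiniteOrder.
Variables (T : finType) (lt : rel T).
Hypothesis lt_order : strict_total_order (fun x y => lt x y).

Lemma lt_irr x : ~ lt x x.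
Proof. by case: lt_order => -[irr _] _; apply: irr. Qed.

Lemma lt_tr x y z : lt x y -> lt y z -> lt x z.
Proof. by case: lt_order => -[_ tr] _; apply: tr. Qed.

Lemma lt_trichotomy x y : [\/ x = y, lt x y | lt y x].
Proof.
case: (eqVneq x y) => [->|/eqP xy]; first by constructor 1.
by case: lt_order => _ /(_ x y xy) []; [constructor 2 | constructor 3].
Qed.

Lemma opposite_order : strict_total_order (fun x y => opposite lt x y).
Proof.
split; first split.
- by move=> x /lt_irr.
- by move=> x y z yx zy; apply: lt_tr zy yx.
- by move=> x y; case: (lt_trichotomy x y) => [-> []| |] //; [right | left].
Qed.

Definition height (x : T) : nat := #|[pred y | lt y x]|.

Lemma height_lt x y : lt x y -> height x < height y.
Proof.
move=> xy; apply: proper_card; apply/properP; split.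
  by apply/subsetP => z; rewrite !inE => zx; apply: lt_tr zx xy.
by exists x; rewrite inE //; apply/negP => /lt_irr.
Qed.

Lemma lt_wf_ind (P : T -> Prop) :
  (forall x, (forall y, lt y x -> P y) -> P x) -> forall x, P x.
Proof.
move=> step x; have [n] := ubnP (height x).
elim: n x => // n IH x xn; apply: step => y yx; apply: IH.
exact: leq_trans (height_lt yx) xn.
Qed.

(** Stated with an informative conclusion because boundary functions are
    extracted from it. *)
Lemma last_elementP (P : pred T) : (exists x, P x) ->
  {m | P m & forall z, P z -> z != m -> lt z m}.
Proof.
move=> /sigW [x Px]; exists [arg max_(m > x | P m) height m].
  by case: arg_maxnP.
case: arg_maxnP => // m _ mmax z Pz zm.
case: (lt_trichotomy z m) => [zE|//|mz]; first by rewrite zE eqxx in zm.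
by have := leq_trans (height_lt mz) (mmax z Pz); rewrite ltnn.
Qed.

Lemma predecessorP x y : lt y x -> exists p, consecutive lt p x.
Proof.
move=> yx; have [|p px pmax] := @last_elementP (lt^~ x); first by exists y.
exists p; split=> // z [pz zx]; case: (eqVneq z p) => [zE|zp].
  by rewrite zE in pz; case/lt_irr: pz.
by case: (@lt_irr p); apply: lt_tr pz (pmax _ zx zp).
Qed.

Lemma consecutive_le x p z : consecutive lt p x -> lt z x -> z = p \/ lt z p.
Proof.
move=> [_ gap] zx; case: (lt_trichotomy z p) => [->|zp|pz]; [by left| by right|].
by case: (gap z).
Qed.

Lemma lt_clos_consecutive x y :
  lt x y -> clos_trans T (consecutive lt) x y.
Proof.
elim/lt_wf_ind: y => y IH xy; have [p py] := predecessorP xy.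
have [->|xp] := consecutive_le py xy; first exact: t_step.
by apply: t_trans (t_step _ _ _ _ py); apply: IH xp; case: py.
Qed.

Lemma last_face_uniq (dim : T -> nat) x y y' :
  last_face_before lt dim x y -> last_face_before lt dim x y' -> y = y'.
Proof.
move=> [yx dy ymax] [y'x dy' y'max]; case: (eqVneq y y') => // yy'.
case: (@lt_irr y); apply: (@lt_tr y y'); first exact: y'max.
by apply: ymax => //; rewrite eq_sym.
Qed.

Lemma consecutive_last_face (dim : T -> nat) x y : consecutive lt x y ->
  dim y = (dim x).+1 -> last_face_before lt dim y x.
Proof.
move=> c dy; split; [by case: c | by rewrite dy |].
move=> z zy _ /eqP zx.
by case: (consecutive_le c zy).
Qed.

End FiniteOrder.

Lemma successorP (T : finType) (lt : rel T) x y :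
    strict_total_order (fun x y => lt x y) -> lt x y ->
  exists s, consecutive lt x s.
Proof.
move=> /opposite_order ord xy.
have [s [xs gap]] := predecessorP ord (xy : opposite lt y x).
by exists s; split=> // z [xz zs]; apply: (gap z).
Qed.

Lemma consecutive_opposite (T : finType) (lt : rel T) x y :
  consecutive (opposite lt) x y -> consecutive lt y x.
Proof. by move=> [xy gap]; split=> // z [yz zx]; apply: (gap z). Qed.

Lemma consecutive_first_face (T : finType) (lt : rel T) (dim : T -> nat) x y :
    strict_total_order (fun x y => lt x y) -> consecutive lt x y ->
  dim x = (dim y).+1 -> first_face_after lt dim x y.
Proof.
move=> /opposite_order ord /(@consecutive_opposite _ (opposite lt)) c dx.
exact: (consecutive_last_face ord c dx).
Qed.

(** * Faces in a continuously graded ordered set *)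

Lemma cgos_opposite (T : finType) (lt : rel T) (dim : T -> nat) :
  cont_graded_ordered_set lt dim ->
  cont_graded_ordered_set (opposite lt) dim.
Proof.
case=> ord ne first last step; split=> //; first exact: opposite_order.
by move=> x y /consecutive_opposite /step []; [right | left].
Qed.

Section Faces.
Variables (T : finType) (lt : rel T) (dim : T -> nat).
Hypothesis X : cont_graded_ordered_set lt dim.
Let ord := cgos_order X.

(** The last element of dimension at most [d] before [x] is followed by an
    element of larger dimension, hence has dimension exactly [d]. *)
Lemma dim_ivt d x y : lt y x -> dim y <= d < dim x ->
  exists z, [/\ z = y \/ lt y z, lt z x & dim z = d].
Proof.
move=> yx /andP[yd dx].
have [|m] := @last_elementP _ _ ord
    [pred z | [&& (z == y) || lt y z, lt z x & dim z <= d]].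
  by exists y; rewrite /= eqxx yx.
move=> /and3P[ym mx md] mmax; exists m; split=> //.
  by case/orP: ym => [/eqP|]; [left | right].
have [s [ms gap]] := successorP ord mx.
have ds : d < dim s.
  case: (lt_trichotomy ord s x) => [->//|sx|xs]; last by case: (gap x).
  rewrite ltnNge; apply/negP => sd; apply: (@lt_irr _ _ ord m).
  apply: (lt_tr ord ms); apply: mmax.
    rewrite /= sx sd (_ : lt y s) ?orbT //.
    by case/orP: ym => [/eqP<-//|ym]; apply: lt_tr ym ms.
  by apply/eqP => sE; rewrite sE in ms; case: (lt_irr ord ms).
case: (cgos_step X (conj ms gap)) => dE; apply/eqP; rewrite eqn_leq md /=.
  by rewrite dE in ds.
by rewrite dE ltnW // ltnW.
Qed.

Lemma positive_dim_above x : 0 < dim x -> exists2 y, lt y x & dim y = 0.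
Proof.
move=> dx.
have [|f _ fmin] := @last_elementP _ _ (opposite_order ord) predT.
  by exists x.
have df : dim f = 0 by apply: (cgos_first X) => y; apply: fmin.
exists f => //; apply: fmin => //.
by apply/eqP => xE; rewrite xE df in dx.
Qed.

Lemma last_faceP x : 0 < dim x -> {y | last_face_before lt dim x y}.
Proof.
move=> dx.
have [|m] := @last_elementP _ _ ord
    [pred z | lt z x && (dim z == (dim x).-1)].
  have [y yx dy] := positive_dim_above dx.
  have [|z [_ zx dz]] := @dim_ivt (dim x).-1 x y yx.
    by rewrite dy ltn_predL.
  by exists z; rewrite /= zx dz eqxx.
move=> /andP[mx /eqP dm] mmax; exists m; split=> // z zx dz.
by apply: mmax; rewrite /= zx dz eqxx.
Qed.

(** An element between [s] and [x] of dimension below that of [x] would be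
    followed, still before [x], by a face of [x] later than [s]. *)
Lemma last_face_gap x s z : last_face_before lt dim x s ->
  lt s z -> lt z x -> dim x <= dim z.
Proof.
move=> [sx ds smax] sz zx; rewrite leqNgt; apply/negP => dzx.
have dx : 0 < dim x by apply: leq_trans dzx.
have [|w [zw wx dw]] := @dim_ivt (dim x).-1 x z zx.
  by rewrite ltn_predL dx -ltnS prednK // dzx.
have sw : lt s w by case: zw => [->//|]; apply: lt_tr.
apply: (@lt_irr _ _ ord s); apply: (lt_tr ord sw); apply: smax => //.
by apply/eqP => wE; rewrite wE in sw; case: (lt_irr ord sw).
Qed.

End Faces.

Lemma first_face_gap (T : finType) (lt : rel T) (dim : T -> nat) x t z :
    cont_graded_ordered_set lt dim -> first_face_after lt dim x t ->
  lt x z -> lt z t -> dim x <= dim z.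
Proof.
move=> /cgos_opposite X f xz zt.
exact: (last_face_gap X f).
Qed.

(** The globular identity on sources, in a form that does not presuppose
    boundary functions: the elements strictly between [s] and [t] are too
    high to be faces of [t]. *)
Lemma last_face_src_tgt (T : finType) (lt : rel T) (dim : T -> nat) x s t a :
    cont_graded_ordered_set lt dim -> 1 < dim x ->
    last_face_before lt dim x s -> first_face_after lt dim x t ->
  last_face_before lt dim s a -> last_face_before lt dim t a.
Proof.
move=> X dx fs ft [as_ da amax]; have ord := cgos_order X.
have [[sx ds _] [xt dt _]] := (fs, ft).
split; first exact: lt_tr as_ (lt_tr ord sx xt).
  by rewrite da ds dt.
move=> z zt; rewrite dt -ds => dz; apply: amax => //.
have low : dim z < dim s.
  by rewrite dz ltn_predL ds; case: (dim x) dx.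
have lowx : dim z < dim x by apply: leq_trans low _; rewrite ds leq_pred.
case: (lt_trichotomy ord z s) => [zE|//|sz]; first by rewrite zE ltnn in low.
case: (lt_trichotomy ord z x) => [zE|zx|xz]; first by rewrite zE ltnn in lowx.
  by have := last_face_gap X fs sz zx; rewrite leqNgt lowx.
by have := first_face_gap X ft xz zt; rewrite leqNgt lowx.
Qed.

(** * From continuously graded ordered sets to simple globular sets *)

Lemma order_globular (T : finType) (lt : rel T) (dim : T -> nat)
    (src tgt : boundary dim) :
    cont_graded_ordered_set lt dim -> boundaries_from_order lt src tgt ->
  globular_set src tgt.
Proof.
move=> X B; split.
- by move=> x hx; case: (B x hx) => -[].
- by move=> x hx; case: (B x hx) => _ [].
- move=> x dx hx hs ht; have [fs ft] := B x hx.
  apply: (last_face_uniq (cgos_order X)) (proj1 (B _ ht)).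
  exact: last_face_src_tgt X dx fs ft (proj1 (B _ hs)).
- move=> x dx hx hs ht; have [fs ft] := B x hx.
  have X' := cgos_opposite X.
  apply: (last_face_uniq (cgos_order X')) (proj2 (B _ hs)) _.
  exact: (last_face_src_tgt X' dx ft fs (proj2 (B _ ht))).
Qed.

Lemma order_clos_step (T : finType) (lt : rel T) (dim : T -> nat)
    (src tgt : boundary dim) :
    cont_graded_ordered_set lt dim -> boundaries_from_order lt src tgt ->
  forall x y, clos_trans T (globular_step src tgt) x y <-> lt x y.
Proof.
move=> X B x y; have ord := cgos_order X; split.
  elim=> {x y} [x y [[hy ->]|[hx ->]]|x y z _ xy _ yz].
  - by case: (B y hy) => -[].
  - by case: (B x hx) => _ [].
  - exact: lt_tr xy yz.
move=> /(lt_clos_consecutive ord).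
elim=> {x y} [x y c|x y z _ xy _ yz]; last exact: t_trans yz.
apply: t_step; case: (cgos_step X c) => d.
  have hy : 0 < dim y by rewrite d.
  left; exists hy; apply: (last_face_uniq ord) (proj1 (B y hy)).
  exact: (consecutive_last_face ord c d).
have hx : 0 < dim x by rewrite d.
right; exists hx; apply: (last_face_uniq (opposite_order ord)) (proj2 (B x hx)).
exact: (consecutive_first_face ord c d).
Qed.

Lemma order_simple_globular (T : finType) (lt : rel T) (dim : T -> nat)
    (src tgt : boundary dim) :
    cont_graded_ordered_set lt dim -> boundaries_from_order lt src tgt ->
  simple_globular_set src tgt.
Proof.
move=> X B; have E := order_clos_step X B; have ord := cgos_order X.
split; [exact: order_globular X B | exact: cgos_nonempty X |].
split; first split.
- by move=> x /E /(lt_irr ord).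
- by move=> x y z /E xy /E yz; apply/E; apply: lt_tr xy yz.
- by move=> x y; case: ord => _ tot /tot [] xy; [left | right]; apply/E.
Qed.

(** * From simple globular sets to continuously graded ordered sets *)

Lemma globular_opposite (T : Type) (dim : T -> nat) (src tgt : boundary dim) :
  globular_set src tgt -> globular_set tgt src.
Proof. by case=> ds dt ss tt; split=> // x dx hx hs ht; symmetry; auto. Qed.

(** Here the order and the boundaries are related only through consecutive
    pairs; this hypothesis is invariant under reversing the order and
    exchanging [src] with [tgt], so that targets need no separate proof. *)
Lemma src_last_face (T : finType) (lt : rel T) (dim : T -> nat)
    (src tgt : boundary dim) :
    cont_graded_ordered_set lt dim -> globular_set src tgt ->
    (forall x y, consecutive lt x y -> globular_step src tgt x y) ->
  forall x (hx : 0 < dim x), last_face_before lt dim x (src x hx).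
Proof.
move=> X G S x; have ord := cgos_order X.
elim/(lt_wf_ind ord): x => x IH hx.
have [y yx _] := positive_dim_above X hx.
have [p c] := predecessorP ord yx.
case: (S p x c) => [[hy pE]|[hp xE]].
  (* [p] is the given source of [x], and nothing lies between them. *)
  rewrite (bool_irrelevance hx hy) -pE.
  apply: (consecutive_last_face ord c).
  by rewrite pE (dim_src G) prednK.
have dx : dim x = (dim p).-1 by rewrite xE (dim_tgt G).
have dp : 1 < dim p by rewrite -subn_gt0 subn1 -dx.
have [px _] := c; have fs := IH p px hp; have [sp ds _] := fs.
have hs : 0 < dim (src p hp) by rewrite ds -dx.
have -> : src x hx = src (src p hp) hs.
  clear -G dp xE; subst x.
  by rewrite (src_src_tgt G dp hs hx).
have ft : first_face_after lt dim p x.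
  by apply: (consecutive_first_face ord c); rewrite dx prednK // ltnW.
exact: last_face_src_tgt X dp fs ft (IH _ (lt_tr ord sp px) hs).
Qed.

Lemma simple_globular_order (T : finType) (dim : T -> nat)
    (src tgt : boundary dim) :
    simple_globular_set src tgt ->
  exists lt : rel T,
    cont_graded_ordered_set lt dim /\ boundaries_from_order lt src tgt.
Proof.
case=> G ne ord0; set R := clos_trans T _ in ord0.
pose lt : rel T := fun x y => `[< R x y >].
have ltE x y : lt x y <-> R x y by split=> /asboolP.
have ord : strict_total_order (fun x y => lt x y).
  case: ord0 => -[irr tr] tot; split; first split.
  - by move=> x /ltE /irr.
  - by move=> x y z /ltE xy /ltE yz; apply/ltE; apply: tr xy yz.
  - by move=> x y /tot [] xy; [left | right]; apply/ltE.
(* The first step of a chain from [x] to [y] already reaches [y], as nothing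
   lies between them. *)
have S x y : consecutive lt x y -> globular_step src tgt x y.
  move=> [/ltE /clos_trans_t1n_iff xy gap].
  case: y / xy gap => // z y xz /clos_trans_t1n_iff zy gap.
  by case: (gap z); split; apply/ltE => //; apply: t_step.
have src_lt x hx : lt (src x hx) x.
  by apply/ltE/t_step; left; exists hx.
have lt_tgt x hx : lt x (tgt x hx).
  by apply/ltE/t_step; right; exists hx.
have neq x y : lt x y -> x != y.
  by move=> xy; apply/eqP => xE; rewrite xE in xy; case: (lt_irr ord xy).
have X : cont_graded_ordered_set lt dim.
  split=> //.
  - move=> x fx; case: (posnP (dim x)) => // hx.
    have sx := src_lt x hx; case: (lt_irr ord (lt_tr ord sx _)).
    exact: fx (neq _ _ sx).
  - move=> x lx; case: (posnP (dim x)) => // hx.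
    have xt := lt_tgt x hx; case: (lt_irr ord (lt_tr ord xt _)).
    by apply: lx; rewrite eq_sym neq.
  - move=> x y /S [[hy ->]|[hx ->]].
      by left; rewrite (dim_src G) prednK.
    by right; rewrite (dim_tgt G) prednK.
exists lt; split=> // x hx; split; first exact: (src_last_face X G S).
apply: (src_last_face (cgos_opposite X) (globular_opposite G)).
by move=> {hx}x y /consecutive_opposite /S [] h; [right | left].
Qed.

Theorem theorem2p4 :
  (forall (T : finType) (lt : rel T) (dim : T -> nat),
     cont_graded_ordered_set lt dim ->
     (forall x : T, 0 < dim x ->
        (exists! y : T, last_face_before lt dim x y) /\
        (exists! y : T, first_face_after lt dim x y)) /\
     (exists src tgt : boundary dim,
        boundaries_from_order lt src tgt /\ simple_globular_set src tgt)) /\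
  (forall (T : finType) (dim : T -> nat) (src tgt : boundary dim),
     simple_globular_set src tgt ->
     exists lt : rel T,
       cont_graded_ordered_set lt dim /\ boundaries_from_order lt src tgt).
Proof.
split; last exact: simple_globular_order.
move=> T lt dim X; have X' := cgos_opposite X; split.
  move=> x hx; split.
    have [y fy] := last_faceP X hx; exists y; split=> // y'.
    exact: (last_face_uniq (cgos_order X)).
  have [y fy] := last_faceP X' hx; exists y; split=> // y'.
  exact: (last_face_uniq (cgos_order X') fy).
pose src : boundary dim := fun x hx => sval (last_faceP X hx).
pose tgt : boundary dim := fun x hx => sval (last_faceP X' hx).
have B : boundaries_from_order lt src tgt.
  move=> x hx; split; first exact: svalP (last_faceP X hx).
  exact: svalP (last_faceP X' hx).
by exists src, tgt; split=> //; apply: order_simple_globular X B.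
Qed.
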